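(* Let $C_1,\ldots,C_m\subseteq\mathcal{E}$ be closed convex sets with $C:=\bigcap_{i=1}^m C_i\neq\emptyset$. Let $\{x^k\}_{k\ge0}\subseteq\mathcal{E}$ be a sequence such that: (1) for every $c\in C$, $\|x^{k+1}-c\|\le\|x^k-c\|$ for all $k$; (2) there exist a positive integer $\ell$ and a nonnegative sequence $\{a_k\}_{k\ge 0}$ with $\sum_{k=0}^\infty a_k=\infty$ such that $$\mathrm{dist}^2(x^k,C)\ge\mathrm{dist}^2(x^{k+\ell},C)+a_k\max_{1\le i\le m}\mathrm{dist}^2(x^k,C_i)\quad\forall\,k.$$ Let $\Phi$ be a strict consistent error bound function for $C_1,\ldots,C_m$, and let $\Phi^\spadesuit_{\widehat\kappa}$ be its inverse smoothing function with parameter $\widehat\kappa>0$ satisfying $\widehat\kappa\ge\|x^0\|+2\,\mathrm{dist}(0,C)$. Then either $\{x^k\}$ converges finitely (there is $\bar k$ with $x^k=x^{\bar k}\in C$ for all $k\ge\bar k$), or $$\mathrm{dist}(x^k,C)\le\sqrt{(\Phi^\spadesuit_{\widehat\kappa})^{-1}\Big(\Phi^\spadesuit_{\widehat\kappa}\big(\mathrm{dist}^2(x^0,C)\big)-\sum_{i=0}^{b_k-1}a_{k_0+i\ell}\Big)}\qquad\forall\,k\ge2\ell$$ holds for any integer $k_0\in[0,\ell-1]$, where $b_k:=\frac{k-\ell-(k\bmod\ell)}{\ell}$ (the inequality being understood to include that its right-hand side is well defined).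
   Context: $\mathcal{E}$ is a finite-dimensional real vector space with norm $\|\cdot\|$ induced by an inner product, and $\mathrm{dist}(x,D)=\min_{y\in D}\|x-y\|$ for a nonempty closed convex set $D$. ''Monotone increasing'' means strictly increasing. A function $\Phi:[0,\infty)\times[0,\infty)\to[0,\infty)$ is a consistent error bound function for $C_1,\ldots,C_m$ if: (i) $\mathrm{dist}(x,C)\le\Phi\big(\max_{1\le i\le m}\mathrm{dist}(x,C_i),\|x\|\big)$ for all $x\in\mathcal{E}$; (ii) for every fixed $b\ge 0$, $\Phi(\cdot,b)$ is monotone nondecreasing on $[0,\infty)$, right-continuous at $0$, and $\Phi(0,b)=0$; (iii) for every fixed $a\ge0$, $\Phi(a,\cdot)$ is monotone nondecreasing on $[0,\infty)$. It is strict if in addition $\Phi(\cdot,b)$ is monotone increasing on $[0,\infty)$ for every $b>0$. For a monotone increasing $f:[0,\infty)\to[0,\infty)$, the generalized inverse is $f^-(s):=\inf\{t\ge0: f(t)\ge s\}$ for $0\le s<\sup f$. For strict $\Phi$ and $\kappa>0$, set $\phi_{\kappa,\Phi}(t):=(\Phi(\sqrt t,\kappa))^2$, $t\ge0$. The inverse smoothing function is $$\Phi^\spadesuit_\kappa(t):=\int_\delta^t\frac{1}{\phi_{\kappa,\Phi}^-(s)}\,ds,\qquad t\in(0,\sup\phi_{\kappa,\Phi}),$$ where $\delta\in(0,\sup\phi_{\kappa,\Phi})$ is some fixed (arbitrary) number. It is strictly increasing and continuous, and $(\Phi^\spadesuit_\kappa)^{-1}$ denotes its inverse, defined on its range. 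*)

(* Defs.v *)
From HB Require Import structures.
From mathcomp Require Export all_boot all_order all_algebra.
From mathcomp Require Export all_classical all_reals all_analysis.
Set Implicit Arguments.
Unset Strict Implicit.
Unset Printing Implicit Defensive.
Import Order.TTheory GRing.Theory Num.Theory.
Import numFieldNormedType.Exports.
Local Open Scope classical_set_scope.
Local Open Scope ring_scope.

(* In the theorem D is nonempty, closed and convex in a finite-dimensional
   space, so the infimum is attained. *)
Definition dist (R : realType) (E : normedModType R) (x : E) (D : set E) : R :=
  inf [set `|x - y| | y in D].

(* Functions on [0, +oo[ are represented by functions on R whose values at
   negative arguments are never constrained nor used. *)

Record consistent_error_bound (R : realType) (E : normedModType R) (m : nat)
    (C : 'I_m -> set E) (Phi : R -> R -> R) : Prop := ConsistentErrorBound {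
  ceb_ge0 : forall a b, 0 <= a -> 0 <= b -> 0 <= Phi a b ;
  ceb_dist : forall x : E,
    dist x (\bigcap_i C i)
      <= Phi (\big[Num.max/0]_(i < m) dist x (C i)) `|x| ;
  ceb_nondecreasing_l : forall b, 0 <= b ->
    forall a a', 0 <= a -> a <= a' -> Phi a b <= Phi a' b ;
  ceb_right_continuous : forall b, 0 <= b ->
    Phi a b @[a --> 0^'+] --> Phi 0 b ;
  ceb_at0 : forall b, 0 <= b -> Phi 0 b = 0 ;
  ceb_nondecreasing_r : forall a, 0 <= a ->
    forall b b', 0 <= b -> b <= b' -> Phi a b <= Phi a b' }.

Record strict_consistent_error_bound (R : realType) (E : normedModType R)
    (m : nat) (C : 'I_m -> set E) (Phi : R -> R -> R) : Prop :=
    StrictConsistentErrorBound {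
  sceb_consistent : consistent_error_bound C Phi ;
  sceb_increasing : forall b, 0 < b ->
    forall a a', 0 <= a -> a < a' -> Phi a b < Phi a' b }.

Definition generalized_inverse (R : realType) (f : R -> R) (s : R) : R :=
  inf [set t | 0 <= t /\ s <= f t].

Definition phi (R : realType) (kappa : R) (Phi : R -> R -> R) (t : R) : R :=
  Phi (Num.sqrt t) kappa ^+ 2.

(* ]0, sup f[, where the supremum over [0, +oo[ may be +oo *)
Definition open_range (R : realType) (f : R -> R) : set R :=
  [set t | 0 < t /\
    (t%:E < ereal_sup [set (f u)%:E | u in [set u | (0 <= u)%R]])%E].

Definition oriented_integral (R : realType) (f : R -> R) (a b : R) : R :=
  if a <= b then \int[lebesgue_measure]_(s in `[a, b]) f s
  else - \int[lebesgue_measure]_(s in `[b, a]) f s.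

Definition inverse_smoothing (R : realType) (Phi : R -> R -> R)
    (kappa delta t : R) : R :=
  oriented_integral (fun s => (generalized_inverse (phi kappa Phi) s)^-1)
    delta t.

(* only meaningful on the image of ]0, sup (phi kappa Phi)[ *)
Definition inverse_smoothing_inv (R : realType) (Phi : R -> R -> R)
    (kappa delta : R) : R -> R :=
  'pinv_(fun=> 0) (open_range (phi kappa Phi))
    (inverse_smoothing Phi kappa delta).

(* Main.v *)
Require Import Defs.
From mathcomp Require Import measurable_realfun lra.
Set Implicit Arguments.
Unset Strict Implicit.
Unset Printing Implicit Defensive.
Import Order.TTheory GRing.Theory Num.Theory.
Import numFieldNormedType.Exports.
Local Open Scope classical_set_scope.
Local Open Scope ring_scope.

(** The weight in the inverse smoothing function is [g := 1 / phi^-], where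
[phi^-] is the generalized inverse of [phi kappa Phi]. It is positive and
nonincreasing on the open interval [A] from 0 to [sup phi], since [phi^-] is
nondecreasing there, and positive because [phi] tends to 0 at 0. For [s <= t] in
[A] the primitive [F := inverse_smoothing Phi kappa delta] of [g] thus satisfies
  [(t - s) * g t <= F t - F s <= (t - s) * g s]
([oriented_integral_bounds]). The left bound makes [F] strictly increasing, the
right one locally Lipschitz.

Write [d k := dist (x k) C ^+ 2] and [M k := max_i dist (x k) (C i) ^+ 2].
Fejer monotonicity has two effects. If some [d k] vanishes, the closedness of
[C] puts [x k] in [C] and the sequence is constant from there on. In any case
[`|x k| <= kappa], so that the error bound may be used with the fixed second
argument [kappa] and reads [d k <= phi (M k)] ([dist_sqr_le_phi]), that is,
[phi^- (d k) <= M k]. The decrease hypothesis becomes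
  [a k * phi^- (d k) <= d k - d (k + l)],
and the left bound above turns it into the additive recursion
  [a k <= F (d k) - F (d (k + l))],
which telescopes along [k0, k0 + l, ..., k0 + b * l]
([oriented_integral_descent]). As [k0 + b * l <= k] and [d] is nonincreasing,
  [F (d k) <= F (d 0) - \sum_(i < b) a (k0 + i * l) <= F (d 0)].
By the intermediate value theorem the middle term is a value of [F] on
[[d k, d 0]], which shows at once that its preimage under [F] is defined and
that this preimage is at least [d k] ([pinv_increasing_between]). *)

(** * Primitives of nonincreasing functions *)

(** A monotone function on a segment is bounded by its values at the ends. It is
measurable because composing it with the retraction [clamp] onto the segment
extends it to a monotone function on the whole line. *)
Lemma nonincreasing_integrable (R : realType) (g : R -> R) (a b : R) :
  {in `[a, b] &, {homo g : s t /~ s <= t}} ->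
  lebesgue_measure.-integrable `[a, b] (EFin \o g).
Proof.
move=> g_noninc.
have [ba|ab] := ltP b a; first
  by rewrite set_itv_ge ?bnd_simp -?ltNge//; exact: integrable_set0.
pose clamp t := Num.max a (Num.min b t).
have clamp_itv t : clamp t \in `[a, b].
  by rewrite in_itv/= le_max lexx/= ge_max ab ge_min lexx.
have clamp_id t : t \in `[a, b] -> clamp t = t.
  by rewrite in_itv/= => /andP[at_ tb]; rewrite /clamp min_r// max_r.
have clamp_homo : {homo clamp : s t / s <= t}.
  move=> s t st; rewrite /clamp ge_max le_max lexx/=.
  by rewrite le_max le_min !ge_min lexx st !orbT.
apply: measurable_bounded_integrable => //.
- by rewrite /= lebesgue_measure_itv/= lte_fin; case: ifP => // _; rewrite ltry.
- have : measurable_fun `[a, b] (\- (fun t => - g (clamp t))).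
    apply: measurableT_comp => //; apply: nondecreasing_measurable => // s t st.
    by rewrite lerN2; apply: g_noninc; rewrite ?clamp_itv// clamp_homo.
  apply: eq_measurable_fun => t; rewrite inE/= => tab.
  by rewrite opprK clamp_id.
- exists (Num.max `|g a| `|g b|); split; first exact: num_real.
  move=> M gM t /= tab; apply: le_trans (ltW gM).
  have aab : a \in `[a, b] by rewrite in_itv/= lexx.
  have bab : b \in `[a, b] by rewrite in_itv/= lexx andbT.
  move: (tab); rewrite in_itv/= => /andP[at_ tb].
  have gta := g_noninc _ _ tab aab at_.
  have gbt := g_noninc _ _ bab tab tb.
  have gt_hi : g t <= `|g a| by apply: le_trans gta (ler_norm _).
  have gt_lo : - g t <= `|g b|.
    by rewrite -normrN; apply: le_trans (ler_norm _); rewrite lerN2.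
  by rewrite ler_norml lerNl !le_max gt_hi gt_lo orbT.
Qed.

Lemma Rintegral_nonincreasing_bounds (R : realType) (g : R -> R) (a b : R) :
  a <= b -> {in `[a, b] &, {homo g : s t /~ s <= t}} ->
  (b - a) * g b <= \int[lebesgue_measure]_(s in `[a, b]) g s <= (b - a) * g a.
Proof.
move=> ab g_noninc.
have intg := nonincreasing_integrable g_noninc.
have intc (c : R) : \int[lebesgue_measure]_(s in `[a, b]) c = (b - a) * c.
  rewrite Rintegral_cst//= lebesgue_measure_itv/= lte_fin mulrC.
  by case: ltgtP ab => // -> _; rewrite subrr.
have intgc (c : R) : lebesgue_measure.-integrable `[a, b] (EFin \o cst c).
  exact: nonincreasing_integrable.
have aab : a \in `[a, b] by rewrite in_itv/= lexx.
have bab : b \in `[a, b] by rewrite in_itv/= lexx andbT.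
rewrite -!intc; apply/andP.
split; apply: le_Rintegral => //; first exact: intgc.
- move=> t /= tab; apply: g_noninc => //.
  by move: tab; rewrite in_itv/= => /andP[].
- exact: intgc.
- move=> t /= tab; apply: g_noninc => //.
  by move: tab; rewrite in_itv/= => /andP[].
Qed.

Lemma Rintegral_itv_cat (R : realType) (g : R -> R) (a b c : R) :
  a <= b -> b <= c -> lebesgue_measure.-integrable `[a, c] (EFin \o g) ->
  \int[lebesgue_measure]_(s in `[a, c]) g s =
  \int[lebesgue_measure]_(s in `[a, b]) g s +
  \int[lebesgue_measure]_(s in `[b, c]) g s.
Proof.
move=> ab bc intg; apply/eqP; rewrite addrC -subr_eq; apply/eqP.
rewrite Rintegral_itvB// ?bnd_simp//.
apply: Rintegral_itv_obnd_cbnd; apply: integrableS intg => //.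
by apply: subset_itv; rewrite bnd_simp.
Qed.

Lemma oriented_integralB (R : realType) (A : set R) (g : R -> R) (d s t : R) :
  is_interval A -> {in A &, {homo g : s t /~ s <= t}} ->
  A d -> A s -> A t -> s <= t ->
  oriented_integral g d t - oriented_integral g d s =
  \int[lebesgue_measure]_(r in `[s, t]) g r.
Proof.
move=> A_itv g_noninc Ad As At st.
have intg a b : A a -> A b -> lebesgue_measure.-integrable `[a, b] (EFin \o g).
  move=> Aa Ab; apply: nonincreasing_integrable => p q.
  rewrite !in_itv/= => pab qab; apply: g_noninc; rewrite inE.
  - exact: A_itv pab.
  - exact: A_itv qab.
rewrite /oriented_integral.
case: (leP d t) => [dt|td]; case: (leP d s) => [ds|sd].
- by rewrite (Rintegral_itv_cat ds st (intg _ _ Ad At)) addrC addKr.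
- by rewrite opprK addrC -Rintegral_itv_cat ?(ltW sd)//; exact: intg.
- by have := lt_le_trans td ds; rewrite ltNge st.
- by rewrite opprK (Rintegral_itv_cat st (ltW td) (intg _ _ As Ad)) addrC addrK.
Qed.

(** The two values of a nonincreasing integrand at the ends of a segment bound
its mean there; the monotonicity and the continuity of the primitive, and the
descent inequality below, all come from this. *)
Lemma oriented_integral_bounds (R : realType) (A : set R) (g : R -> R)
    (d s t : R) :
  is_interval A -> {in A &, {homo g : s t /~ s <= t}} ->
  A d -> A s -> A t -> s <= t ->
  (t - s) * g t <= oriented_integral g d t - oriented_integral g d s
    <= (t - s) * g s.
Proof.
move=> A_itv g_noninc Ad As At st; rewrite (oriented_integralB A_itv)//.
apply: Rintegral_nonincreasing_bounds => // p q.
by rewrite !in_itv/= => pst qst; apply: g_noninc; rewrite inE;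
  [exact: A_itv pst|exact: A_itv qst].
Qed.

Lemma oriented_integral_lt (R : realType) (A : set R) (g : R -> R) (d : R) :
  is_interval A -> {in A &, {homo g : s t /~ s <= t}} ->
  (forall t, A t -> 0 < g t) -> A d ->
  {in A &, {homo oriented_integral g d : s t / s < t}}.
Proof.
move=> A_itv g_noninc g_gt0 Ad s t; rewrite !inE => As At st.
have /andP[+ _] := oriented_integral_bounds A_itv g_noninc Ad As At (ltW st).
by rewrite -subr_gt0; apply: lt_le_trans; rewrite mulr_gt0 ?subr_gt0// g_gt0.
Qed.

(** On the segment the integrand is bounded by its values at the two ends, so
the primitive is Lipschitz there. *)
Lemma oriented_integral_continuous (R : realType) (A : set R) (g : R -> R)
    (d a b : R) :
  is_interval A -> {in A &, {homo g : s t /~ s <= t}} ->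
  A d -> A a -> A b -> {within `[a, b], continuous (oriented_integral g d)}.
Proof.
move=> A_itv g_noninc Ad Aa Ab.
set F := oriented_integral g d.
have sub t : `[a, b]%classic t -> A t.
  by move=> /=; rewrite in_itv/=; exact: A_itv.
apply/subspace_continuousP => t tab; apply/cvgrPdist_le => e e0.
have ga0 : 0 < `|g a| + `|g b| + 1 by rewrite ltr_wpDl// addr_ge0.
have g_bd s : `[a, b]%classic s -> `|g s| <= `|g a| + `|g b| + 1.
  move=> sab; have As := sub _ sab.
  move: sab; rewrite /= in_itv/= => /andP[as_ sb].
  have := g_noninc _ _ (mem_set As) (mem_set Aa) as_.
  have := g_noninc _ _ (mem_set Ab) (mem_set As) sb.
  have := ler_norm (g a); have := ler_norm (- g b); rewrite normrN.
  have := normr_ge0 (g a); have := normr_ge0 (g b).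
  by move=> ? ? ? ? ? ?; rewrite ler_norml; apply/andP; split; lra.
have F_le p q : `[a, b]%classic p -> `[a, b]%classic q -> p <= q ->
    `|F q - F p| <= (`|g a| + `|g b| + 1) * (q - p).
  move=> pab qab pq.
  have /andP[lo hi] :=
    oriented_integral_bounds A_itv g_noninc Ad (sub _ pab) (sub _ qab) pq.
  have := g_bd _ pab; have := g_bd _ qab; rewrite !ler_norml.
  move=> /andP[gq1 gq2] /andP[gp1 gp2]; apply/andP; split.
    by apply: le_trans lo; rewrite mulrC -mulrN ler_wpM2l// subr_ge0.
  by apply: le_trans hi _; rewrite mulrC ler_wpM2r// subr_ge0.
(* The added 1 in the Lipschitz constant allows dividing by it. *)
set K := `|g a| + `|g b| + 1 in ga0 g_bd F_le.
rewrite near_withinE; apply: filterS (nbhsx_ballx t (e / K) (divr_gt0 e0 ga0)).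
move=> s /ltW ts sab.
have {}ts : K * `|t - s| <= e by rewrite mulrC -ler_pdivlMr.
have [st|/ltW st] := leP s t.
  by rewrite (le_trans (F_le _ _ sab tab st))// -[t - s]ger0_norm// subr_ge0.
rewrite distrC (le_trans (F_le _ _ tab sab st))//.
by rewrite -[s - t]ger0_norm ?subr_ge0// distrC.
Qed.

(** Discrete analogue of integrating [- D' >= a / g D]: since [g] is
nonincreasing, one step of [D] changes the primitive by at least
[(D i - D i.+1) * g (D i) >= a i], and the steps telescope. *)
Lemma oriented_integral_descent (R : realType) (A : set R) (g : R -> R) (d : R)
    (D a : nat -> R) (n : nat) :
  is_interval A -> {in A &, {homo g : s t /~ s <= t}} ->
  (forall t, A t -> 0 < g t) -> A d ->
  (forall i, A (D i)) -> (forall i, 0 <= a i) ->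
  (forall i, a i / g (D i) <= D i - D i.+1) ->
  \sum_(0 <= i < n) a i
    <= oriented_integral g d (D 0%N) - oriented_integral g d (D n).
Proof.
move=> A_itv g_noninc g_gt0 Ad AD a_ge0 aD.
rewrite -opprB.
rewrite -(telescope_sumr (fun i => oriented_integral g d (D i)) (leq0n n)).
rewrite -sumrN; apply: ler_sum => i _.
rewrite opprB.
have D_le : D i.+1 <= D i.
  by rewrite -subr_ge0 (le_trans _ (aD i))// divr_ge0// ltW// g_gt0.
have /andP[lo _] :=
  oriented_integral_bounds A_itv g_noninc Ad (AD i.+1) (AD i) D_le.
by apply: le_trans lo; rewrite -ler_pdivrMr ?g_gt0.
Qed.

(** The bound [F s <= u <= F t] serves twice: through the intermediate value
theorem it shows that [u] is attained, and through monotonicity it locates the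
point where it is. *)
Lemma pinv_increasing_between (R : realType) (A : set R) (F dflt : R -> R)
    (s t u : R) :
  is_interval A -> {in A &, {homo F : p q / p < q}} ->
  A s -> A t -> s <= t -> {within `[s, t], continuous F} ->
  F s <= u <= F t ->
  (F @` A) u /\ s <= 'pinv_dflt A F u.
Proof.
move=> A_itv F_lt As At st F_cont su.
have F_inj : {in A &, injective F}.
  move=> p q Ap Aq; case: (ltgtP p q) => // [/F_lt|/F_lt].
    by move=> /(_ Ap Aq) + Fpq; rewrite Fpq ltxx.
  by move=> /(_ Aq Ap) + Fpq; rewrite Fpq ltxx.
have /andP[suF sut] := su.
have Fst := le_trans suF sut.
have [v vst Fv] : exists2 v, v \in `[s, t] & F v = u.
  by apply: IVT => //; rewrite min_l// max_r.
move: vst; rewrite in_itv/= => vst.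
have Av : A v by exact: A_itv vst.
split; first by exists v.
by rewrite -Fv pinvKV ?inE//; case/andP: vst.
Qed.

(** * Generalized inverses *)

Section generalized_inverse.
Context (R : realType).
Implicit Types (f : R -> R) (s t : R).

Lemma open_range_is_interval f : is_interval (open_range f).
Proof.
move=> s t [s0 _] [_ tf] r /andP[sr rt]; split; first exact: lt_le_trans sr.
by apply: le_lt_trans tf; rewrite lee_fin.
Qed.

Lemma open_rangeP f s :
  0 < s -> (exists2 t, 0 <= t & s < f t) -> open_range f s.
Proof.
move=> s0 [t t0 sft]; split => //; apply/ereal_sup_gtP.
by exists (f t)%:E; [exists t|rewrite lte_fin].
Qed.

Lemma generalized_inverse_le f s t :
  0 <= t -> s <= f t -> generalized_inverse f s <= t.
Proof. by move=> t0 sft; apply: ge_inf => //; exists 0 => r []. Qed.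

Lemma open_range_superlevel f s : open_range f s ->
  [set t | 0 <= t /\ s <= f t] !=set0.
Proof.
move=> [_ /ereal_sup_gtP[_ [t t0 <-]]]; rewrite lte_fin => /ltW sft.
by exists t.
Qed.

Lemma generalized_inverse_homo f :
  {in open_range f &, {homo generalized_inverse f : s t / s <= t}}.
Proof.
move=> s t _ /set_mem ft st.
apply: lb_le_inf; first exact: open_range_superlevel ft.
by move=> r [r0 tfr]; apply: generalized_inverse_le => //; exact: le_trans tfr.
Qed.

(** Without arbitrarily small values of [f] near 0 the infimum could be 0: if
[f] jumps at 0, every level below the jump has generalized inverse 0. *)
Lemma generalized_inverse_gt0 f s :
  {in [pred t | 0 <= t] &, {homo f : p q / p <= q}} ->
  open_range f s -> (exists2 e, 0 < e & f e < s) ->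
  0 < generalized_inverse f s.
Proof.
move=> f_homo fs [e e0 fes]; apply: lt_le_trans e0 _.
apply: lb_le_inf; first exact: open_range_superlevel fs.
move=> r [r0 sfr]; rewrite leNgt; apply/negP => re.
have : f r <= f e by apply: f_homo; rewrite ?inE// ltW// (le_lt_trans r0).
by rewrite leNgt (lt_le_trans fes sfr).
Qed.

End generalized_inverse.

(** * Distance to a set *)

Section dist.
Context (R : realType) (E : normedModType R).
Implicit Types (D : set E) (y z c : E).

Lemma dist_le_norm D y c : D c -> dist y D <= `|y - c|.
Proof. by move=> Dc; apply: ge_inf; [exists 0 => _ [z _ <-]|exists c]. Qed.

Lemma le_dist D y (r : R) : D !=set0 ->
  (forall c, D c -> r <= `|y - c|) -> r <= dist y D.
Proof.
move=> [c Dc] ryD; apply: lb_le_inf; first by exists `|y - c|, c.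
by move=> _ [z Dz <-]; exact: ryD.
Qed.

Lemma dist_ge0 D y : D !=set0 -> 0 <= dist y D.
Proof. by move=> D0; exact: le_dist. Qed.

Lemma dist_eq0_closed D y : D !=set0 -> closed D -> dist y D = 0 -> D y.
Proof.
move=> D0 D_closed yD0; apply: D_closed => B /nbhs_ballP[e /= e0 eB].
have : has_inf [set `|y - z| | z in D].
  by split; [case: D0 => c Dc; exists `|y - c|, c|exists 0 => _ [z _ <-]].
move=> /(inf_adherent e0)[_ [c Dc <-]].
rewrite -/(dist y D) yD0 add0r => yce; exists c; split => //.
by apply: eB; rewrite -ball_normE.
Qed.

End dist.

(** * The function phi attached to a strict error bound *)

Section phi_of_strict_error_bound.
Context (R : realType) (E : normedModType R) (m : nat) (C : 'I_m -> set E).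
Context (Phi : R -> R -> R) (Phi_strict : strict_consistent_error_bound C Phi).
Context (kappa : R) (kappa_gt0 : 0 < kappa).

Lemma phi_lt : {in [pred t | 0 <= t] &, {homo phi kappa Phi : s t / s < t}}.
Proof.
move=> s t /[!inE] s0 t0 st; have [ceb sceb] := Phi_strict.
rewrite /phi ltr_pXn2r ?nnegrE ?(ceb_ge0 ceb) ?sqrtr_ge0 ?ltW//.
apply: sceb; rewrite ?sqrtr_ge0//.
by rewrite ltr_sqrt// (le_lt_trans s0 st).
Qed.

Lemma phi_le : {in [pred t | 0 <= t] &, {homo phi kappa Phi : s t / s <= t}}.
Proof.
move=> s t s0 t0; rewrite le_eqVlt => /predU1P[->//|st].
by apply: ltW; exact: phi_lt.
Qed.

(** This is where the right-continuity of [Phi] at 0 enters. *)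
Lemma phi_small s : 0 < s -> exists2 e, 0 < e & phi kappa Phi e < s.
Proof.
move=> s0; have [ceb _] := Phi_strict.
have := ceb_right_continuous ceb (ltW kappa_gt0).
rewrite (ceb_at0 ceb (ltW kappa_gt0)) => Phi_cvg.
have sqs0 : 0 < Num.sqrt s by rewrite sqrtr_gt0.
have : \forall h \near 0^'+, 0 < h /\ Phi h kappa < Num.sqrt s.
  near=> h; split; first by near: h; exact: nbhs_right_gt.
  by near: h; apply: (cvgr_lt 0).
move=> /filter_ex[h [h0 hs]]; exists (h ^+ 2); first by rewrite exprn_gt0.
rewrite /phi sqrtr_sqr gtr0_norm// -[ltRHS]sqr_sqrtr ?ltW//.
by rewrite ltr_pXn2r ?nnegrE ?(ceb_ge0 ceb) ?ltW.
Unshelve. all: by end_near. Qed.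

Lemma generalized_inverse_phi_gt0 s :
  open_range (phi kappa Phi) s -> 0 < generalized_inverse (phi kappa Phi) s.
Proof.
move=> fs; apply: generalized_inverse_gt0 => //; first exact: phi_le.
by apply: phi_small; case: fs.
Qed.

Lemma inv_generalized_inverse_phi_nonincreasing :
  {in open_range (phi kappa Phi) &,
    {homo (fun s => (generalized_inverse (phi kappa Phi) s)^-1) :
      s t /~ s <= t}}.
Proof.
move=> s t /[!inE] fs ft ts.
rewrite lef_pV2 ?posrE ?generalized_inverse_phi_gt0//.
by apply: generalized_inverse_homo; rewrite ?inE.
Qed.

(** The error bound with its second argument frozen at [kappa] and all distances
squared. Only one direction of [max^2 = max of squares] is needed, since [Phi]
is monotone in its first argument. *)
Lemma dist_sqr_le_phi y : \bigcap_i C i !=set0 -> `|y| <= kappa ->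
  dist y (\bigcap_i C i) ^+ 2
    <= phi kappa Phi (\big[Num.max/0]_(i < m) (dist y (C i) ^+ 2)).
Proof.
move=> C0 yk; have [ceb _] := Phi_strict.
have Ci0 i : C i !=set0 by case: C0 => c Cc; exists c; exact: Cc.
set M := \big[_/_]_i _; set M' := \big[Num.max/0]_(i < m) dist y (C i).
have M'0 : 0 <= M' by exact: bigmax_ge_id.
have M'M : M' <= Num.sqrt M.
  apply: bigmax_le => [|i _]; first exact: sqrtr_ge0.
  rewrite -[dist _ _]ger0_norm ?dist_ge0// -sqrtr_sqr ler_wsqrtr//.
  exact: (le_bigmax _ (fun i => dist y (C i) ^+ 2)).
rewrite /phi ler_pXn2r ?nnegrE ?dist_ge0 ?(ceb_ge0 ceb) ?sqrtr_ge0
  ?(ltW kappa_gt0)//.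
apply: le_trans (ceb_dist ceb y) _.
apply: le_trans (ceb_nondecreasing_r ceb M'0 (normr_ge0 y) yk) _.
exact: (ceb_nondecreasing_l ceb (ltW kappa_gt0)).
Qed.

End phi_of_strict_error_bound.

(** * Convergence rate *)

Theorem theorem4p7 (R : realType) (E : normedModType R)
    (dimE : nat) (E_findim : Vector.axiom dimE E)
    (dot : {dot E for idfun})
    (norm_dot : forall v : E, `|v| = Num.sqrt (dot v v))
    (m : nat) (m_gt0 : (0 < m)%N) (C : 'I_m -> set E)
    (C_closed : forall i, closed (C i))
    (C_convex : forall i, convex_set (C i : set (convex_lmodType E)))
    (C_nonempty : \bigcap_i C i !=set0)
    (x : nat -> E)
    (x_fejer : forall c, (\bigcap_i C i) c ->
       forall k, `|x k.+1 - c| <= `|x k - c|)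
    (l : nat) (l_gt0 : (0 < l)%N)
    (a : nat -> R) (a_ge0 : forall k, 0 <= a k)
    (a_sum : (\sum_(0 <= k <oo) (a k)%:E)%E = +oo%E)
    (x_decrease : forall k,
       dist (x (k + l)%N) (\bigcap_i C i) ^+ 2
         + a k * \big[Num.max/0]_(i < m) (dist (x k) (C i) ^+ 2)
       <= dist (x k) (\bigcap_i C i) ^+ 2)
    (Phi : R -> R -> R) (Phi_strict : strict_consistent_error_bound C Phi)
    (kappa : R) (kappa_gt0 : 0 < kappa)
    (kappa_ge : `|x 0%N| + 2 * dist 0 (\bigcap_i C i) <= kappa)
    (delta : R) (delta_range : open_range (phi kappa Phi) delta) :
  (exists kbar, forall k, (kbar <= k)%N ->
     x k = x kbar /\ (\bigcap_i C i) (x kbar))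
  \/
  (forall k0 : nat, (k0 < l)%N -> forall k : nat, (2 * l <= k)%N ->
     let d0 := dist (x 0%N) (\bigcap_i C i) ^+ 2 in
     let b := ((k - l - k %% l) %/ l)%N in
     let u := inverse_smoothing Phi kappa delta d0
              - \sum_(0 <= i < b) a (k0 + i * l)%N in
     [/\ open_range (phi kappa Phi) d0,
         (inverse_smoothing Phi kappa delta @` open_range (phi kappa Phi)) u
       & dist (x k) (\bigcap_i C i)
           <= Num.sqrt (inverse_smoothing_inv Phi kappa delta u)]).
Proof.
set CC := \bigcap_i C i in C_nonempty x_fejer x_decrease kappa_ge *.
have fejer j k c : CC c -> (j <= k)%N -> `|x k - c| <= `|x j - c|.
  move=> Cc; elim: k => [|k IH]; first by rewrite leqn0 => /eqP->.
  rewrite leq_eqVlt => /predU1P[->//|jk].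
  by rewrite (le_trans (x_fejer c Cc k))// IH.
have dist_noninc j k : (j <= k)%N -> dist (x k) CC <= dist (x j) CC.
  move=> jk; apply: le_dist => // c Cc.
  exact: le_trans (dist_le_norm (x k) Cc) (fejer _ _ _ Cc jk).
(* Finite convergence happens exactly when some distance vanishes; otherwise
   all squared distances lie in the open interval where [F] is defined. *)
have [[j xj0]|dist_neq0] := pselect (exists j, dist (x j) CC = 0).
  left; exists j.
  have Cxj : CC (x j).
    by apply: dist_eq0_closed xj0 => //; exact: closed_bigI.
  move=> k jk; split=> //; apply/eqP; rewrite -subr_eq0 -normr_le0.
  by rewrite (le_trans (fejer _ _ _ Cxj jk))// subrr normr0.
right=> k0 k0l k lk d0 b u.
have dist_gt0 j : 0 < dist (x j) CC.
  rewrite lt_neqAle dist_ge0// andbT eq_sym.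
  by apply/eqP => xj0; apply: dist_neq0; exists j.
have x_le_kappa j : `|x j| <= kappa.
  apply: le_trans kappa_ge; rewrite -lerBlDl mulrC -ler_pdivrMr//.
  apply: le_dist => // c Cc; rewrite ler_pdivrMr// sub0r normrN lerBlDl.
  have := fejer _ _ _ Cc (leq0n j); have := ler_normB (x 0%N) c.
  have := ler_normD (x j - c) c; rewrite subrK; lra.
pose M j := \big[Num.max/0]_(i < m) (dist (x j) (C i) ^+ 2).
have M_ge0 j : 0 <= M j by exact: bigmax_ge_id.
have dist_le_phi j : dist (x j) CC ^+ 2 <= phi kappa Phi (M j).
  exact: dist_sqr_le_phi.
set A := open_range (phi kappa Phi) in delta_range *.
have A_dist j : A (dist (x j) CC ^+ 2).
  apply: open_rangeP; first by rewrite exprn_gt0.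
  (* The level [phi (M j)] itself may equal the squared distance; strict
     monotonicity of [phi] provides a higher one. *)
  exists (M j + 1); first by rewrite addr_ge0.
  apply: le_lt_trans (dist_le_phi j) _.
  by apply: (phi_lt Phi_strict kappa_gt0); rewrite ?inE ?addr_ge0// ltrDl.
pose g s := (generalized_inverse (phi kappa Phi) s)^-1.
have A_itv : is_interval A by exact: open_range_is_interval.
have g_noninc : {in A &, {homo g : s t /~ s <= t}}.
  exact: (inv_generalized_inverse_phi_nonincreasing Phi_strict kappa_gt0).
have g_gt0 s : A s -> 0 < g s.
  by move=> As; rewrite invr_gt0 (generalized_inverse_phi_gt0 Phi_strict).
(* [1 / g (d j)] is [phi^- (d j)], which is at most [M j]. *)
have dist_step j : a j / g (dist (x j) CC ^+ 2)
    <= dist (x j) CC ^+ 2 - dist (x (j + l)%N) CC ^+ 2.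
  rewrite lerBrDl (le_trans _ (x_decrease j))// lerD2l /g invrK ler_wpM2l//.
  apply: generalized_inverse_le; [exact: M_ge0|exact: dist_le_phi].
set F := inverse_smoothing Phi kappa delta in u *.
have F_lt : {in A &, {homo F : s t / s < t}}.
  exact: oriented_integral_lt.
have F_le s t : A s -> A t -> s <= t -> F s <= F t.
  move=> As At; rewrite le_eqVlt => /predU1P[->//|st].
  by apply/ltW/F_lt; rewrite ?inE.
have sqr_dist_noninc i j : (i <= j)%N ->
    dist (x j) CC ^+ 2 <= dist (x i) CC ^+ 2.
  by move=> ij; rewrite ler_pXn2r ?nnegrE ?dist_ge0// dist_noninc.
(* [b * l <= k - l] as [b] is a quotient by [l], and [k0 < l <= k]. *)
have kb : (k0 + b * l <= k)%N.
  apply: leq_trans (leq_add (ltnW k0l) (leq_divM _ _)) _.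
  rewrite -subnDA -leq_subRL ?leq_sub2l ?leq_addr//.
  by rewrite (leq_trans _ lk)// mul2n -addnn leq_addr.
have descent : \sum_(0 <= i < b) a (k0 + i * l)%N
    <= F (dist (x k0) CC ^+ 2) - F (dist (x (k0 + b * l)%N) CC ^+ 2).
  have := @oriented_integral_descent R A g delta
    (fun i => dist (x (k0 + i * l)%N) CC ^+ 2) (fun i => a (k0 + i * l)%N) b.
  rewrite mul0n addn0; apply=> // i.
  by rewrite mulSn [(l + _)%N]addnC addnA.
have d_u : F (dist (x k) CC ^+ 2) <= u <= F d0.
  apply/andP; split; last by rewrite /u gerBl sumr_ge0.
  rewrite /u lerBrDr.
  have := F_le _ _ (A_dist k0) (A_dist 0%N) (sqr_dist_noninc _ _ (leq0n k0)).
  have := F_le _ _ (A_dist k) (A_dist (k0 + b * l)%N) (sqr_dist_noninc _ _ kb).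
  rewrite -/d0; move: descent; lra.
have F_cont := oriented_integral_continuous A_itv g_noninc delta_range
  (A_dist k) (A_dist 0%N).
have [Fu d_le] := pinv_increasing_between (fun=> 0) A_itv F_lt (A_dist k)
  (A_dist 0%N) (sqr_dist_noninc _ _ (leq0n k)) F_cont d_u.
split=> //; first exact: A_dist.
by rewrite -[dist _ _]ger0_norm ?dist_ge0// -sqrtr_sqr ler_wsqrtr.
Qed.
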